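(* Let $\tau$ be a vocabulary consisting of a finite set $\bar a$ of (hard-wired) constant symbols, a finite set $\bar U$ of unary relation symbols, and a finite set $\bar R$ of binary relation symbols. Let $\mathcal{C}$ be a class of finite $\tau$-structures definable in CMSOL. Then the sequence $Sp_{\mathcal{C}}(n)$ is MC-finite.
   Context: Notation: $[n]=\{1,\ldots,n\}$; $\bar a=\{a_1,\ldots,a_{\ell_{\bar a}}\}$. Counting function with hard-wired constants: $Sp_{\mathcal{C}}(n)$ (also written $f_{\mathcal{C}}(n)$) is the number of structures in $\mathcal{C}$ with universe $[n+\ell_{\bar a}]$ in which $a_i$ is interpreted as $n+i$ for every $i\in[\ell_{\bar a}]$; that is, one counts only the possible interpretations of the relation symbols. MC-finite: an integer sequence $s(n)$ is MC-finite if for every positive integer $m$ it satisfies a linear recurrence with constant coefficients modulo $m$: there are $r(m),p(m)\in\mathbb{N}^+$ and integers $\alpha_0,\ldots,\alpha_{p(m)}$ (depending on $m$) such that $s(n+p(m)+1)\equiv\sum_{i=0}^{p(m)}\alpha_i\, s(n+i)\pmod m$ for all $n\ge r(m)$. Equivalently, for every $m$ the sequence $s(n)\bmod m$ is ultimately periodic. CMSOL: Monadic Second Order Logic (first order logic with equality, extended by unary relation variables and quantification over them), further extended by the modular counting quantifiers $\mathrm{C}_{m,r}x\,\phi(x)$, which hold in a structure with universe $A$ iff $|\{b\in A:\phi(b)\}|\equiv r\pmod m$. A class is CMSOL-definable if it is the class of finite structures satisfying some CMSOL sentence over $\tau$. *)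

(* Defs.v *)
From mathcomp Require Import all_boot all_order all_algebra.
From mathcomp Require Import boolp.

Set Implicit Arguments.
Unset Strict Implicit.
Unset Printing Implicit Defensive.

(* The constant symbols a_1, ..., a_l are indexed by 'I_l, a_i being
   represented by the ordinal i - 1. *)
Record vocabulary := Vocabulary {
  nconst : nat;
  unary_sym : finType;
  binary_sym : finType
}.

Definition unary_interp (tau : vocabulary) (T : finType) :=
  {ffun unary_sym tau -> {set T}}.

Definition binary_interp (tau : vocabulary) (T : finType) :=
  {ffun binary_sym tau -> {set T * T}}.

(* The empty universe is allowed. *)
Record structure (tau : vocabulary) := Structure {
  universe : finType;
  const_of : {ffun 'I_(nconst tau) -> universe};
  unary_of : unary_interp tau universe;
  binary_of : binary_interp tau universe
}.

Inductive term (tau : vocabulary) (p : nat) :=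
| Var of 'I_p
| Const of 'I_(nconst tau).

(* [formula tau p q]: CMSOL formulas with free element variables among 'I_p
   and free set variables among 'I_q, in well-scoped de Bruijn form (a
   quantifier binds the variable of index 0).  [Count m r] is the quantifier
   C_{m,r}.  The missing connectives and universal quantifiers are the usual
   classical abbreviations. *)
Inductive formula (tau : vocabulary) : nat -> nat -> Type :=
| Eq p q of term tau p & term tau p : formula tau p q
| Unary p q of unary_sym tau & term tau p : formula tau p q
| Binary p q of binary_sym tau & term tau p & term tau p : formula tau p q
| Mem p q of term tau p & 'I_q : formula tau p q
| Not p q of formula tau p q : formula tau p q
| And p q of formula tau p q & formula tau p q : formula tau p q
| Exists p q of formula tau p.+1 q : formula tau p q
| ExistsSet p q of formula tau p q.+1 : formula tau p q
| Count p q (m r : nat) of (0 < m)%N & formula tau p.+1 q : formula tau p q.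

Definition sentence (tau : vocabulary) := formula tau 0 0.

Section Semantics.
Variables (tau : vocabulary) (S : structure tau).
Local Notation T := (universe S).

Definition eval p (x : p.-tuple T) (t : term tau p) : T :=
  match t with
  | Var i => tnth x i
  | Const c => const_of S c
  end.

Fixpoint sat p q (f : formula tau p q) :
    p.-tuple T -> q.-tuple {set T} -> bool :=
  match f in formula _ p q return p.-tuple T -> q.-tuple {set T} -> bool with
  | Eq _ _ t u => fun x X => eval x t == eval x u
  | Unary _ _ P t => fun x X => eval x t \in unary_of S P
  | Binary _ _ P t u => fun x X => (eval x t, eval x u) \in binary_of S P
  | Mem _ _ t j => fun x X => eval x t \in tnth X j
  | Not _ _ g => fun x X => ~~ sat g x X
  | And _ _ g h => fun x X => sat g x X && sat h x X
  | Exists _ _ g => fun x X => [exists y : T, sat g [tuple of y :: x] X]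
  | ExistsSet _ _ g =>
      fun x X => [exists Y : {set T}, sat g x [tuple of Y :: X]]
  | Count _ _ m r _ g =>
      fun x X => #|[set y : T | sat g [tuple of y :: x] X]| == r %[mod m]
  end.

Definition models (phi : sentence tau) : bool := sat phi [tuple] [tuple].

End Semantics.

Definition structure_class (tau : vocabulary) := structure tau -> Prop.

Definition CMSOL_definable (tau : vocabulary) (C : structure_class tau) : Prop :=
  exists phi : sentence tau, forall S : structure tau, C S <-> models S phi.

(* The universe [n + l] is 'I_(n + l), with k represented by k - 1; thus
   interpreting a_i as n + i is [rshift n]. *)
Definition hardwired (tau : vocabulary) (n : nat)
    (I : unary_interp tau 'I_(n + nconst tau) *
         binary_interp tau 'I_(n + nconst tau)) : structure tau :=
  @Structure tau 'I_(n + nconst tau)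
    [ffun i : 'I_(nconst tau) => rshift n i] I.1 I.2.

Definition Sp (tau : vocabulary) (C : structure_class tau) (n : nat) : nat :=
  #|[set I : unary_interp tau 'I_(n + nconst tau) *
             binary_interp tau 'I_(n + nconst tau) | `[< C (hardwired I) >]]|.

Definition MC_finite (s : nat -> int) : Prop :=
  forall m : nat, (0 < m)%N ->
    exists r p : nat, exists alpha : 'I_p.+1 -> int,
      [/\ (0 < r)%N, (0 < p)%N
        & forall n : nat, (r <= n)%N ->
            (s (n + p + 1)%N = (\sum_(i < p.+1) alpha i * s (n + i)%N)%R
               %[mod m%:Z])%Z].

(* Main.v *)
Require Import Defs.
From mathcomp Require Import all_boot all_order all_algebra.
From mathcomp Require Import all_fingroup boolp.

(** A structure is cut into disjoint blocks in such a way that a pair of points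
    from two distinct blocks is related according to the pair of blocks alone.
    By a Feferman-Vaught argument each block has a type, taken from a finite
    set depending only on the sentence, and the types of the blocks together
    with the relations between blocks decide the sentence.  So one may count
    relations between coloured points, a point of colour q standing for a block
    of type q; a hard-wired constant is a point carrying a singleton unary
    predicate.  Let f(s) be this count for a list of colours s.

    Take N groups of p points of the same colour, p prime, and let (Z/p)^N act
    by rotating each group.  If N >= 2 p^k and the orbit of a configuration has
    fewer than p^k elements, then three rotations of distinct groups agree on
    it; as the relations are binary, each of these rotations fixes it.  Hence
    the number of configurations fixed by no rotation is 0 modulo p^k.  A group
    whose rotation fixes the configuration can be merged into a single point, so
    that with T_q adding a point of colour q and L_q f(s) the sum of
    f(q' :: s) over the colours q' of the circulant structures on p points of
    colour q, this says (T_q^p - L_q)^N f = 0 modulo p^k.  As p > 1, the shifts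
    of f modulo p^k then span a finite module, on which the counting sequence is
    read off the powers of one linear map, hence is ultimately periodic.  The
    Chinese remainder theorem treats the other moduli. *)

Set Implicit Arguments.
Unset Strict Implicit.
Unset Printing Implicit Defensive.

(** * Finite types of blocks *)

Section Types.
Variable tau : vocabulary.
Local Notation csym := 'I_(nconst tau).
Local Notation usym := (unary_sym tau).
Local Notation bsym := (binary_sym tau).

(* Constants are arbitrary unary predicates here, so that a block need not
   contain them. *)
Record rstruct := RStruct {
  carrier : finType;
  cst : csym -> pred carrier;
  una : usym -> pred carrier;
  bin : bsym -> rel carrier
}.

(** Each clause keeps what one block contributes to the whole. For a binary atom this is whether
    each term takes its value in the block, and whether a related pair lies inside it. At [Exists]
    and [Count] the last component is the type seen when the quantified point lies in another
    block. *)
Fixpoint ctype p q (f : formula tau p q) : finType :=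
  match f with
  | Eq _ _ _ _ | Unary _ _ _ _ | Defs.Mem _ _ _ _ => bool
  | Binary _ _ _ _ _ => (bool * bool * bool)%type
  | Not _ _ g => ctype g
  | And _ _ g h => (ctype g * ctype h)%type
  | Exists _ _ g => ({set ctype g} * ctype g)%type
  | ExistsSet _ _ g => {set ctype g}
  | Count _ _ m _ _ g => ({ffun ctype g -> 'I_m} * ctype g)%type
  end.

Section CType.
Variable W : rstruct.
Local Notation T := {set carrier W}.

Definition den p (x : p.-tuple T) (t : term tau p) : T :=
  match t with
  | Var i => tnth x i
  | Const c => [set w | cst c w]
  end.

Variable D : T.

(* The type of the block [D].  An element variable is given by a set: [set w]
   if its value is [w], and set0 if its value lies outside the block. *)
Fixpoint ctype_of p q (f : formula tau p q) : p.-tuple T -> q.-tuple T -> ctype f :=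
  match f in formula _ p q return p.-tuple T -> q.-tuple T -> ctype f with
  | Eq _ _ t u => fun x X => [exists w in D, (w \in den x t) && (w \in den x u)]
  | Unary _ _ P t => fun x X => [exists w in D, (w \in den x t) && una P w]
  | Binary _ _ R t u => fun x X =>
      ([exists w in D, w \in den x t], [exists w in D, w \in den x u],
       [exists w in D, (w \in den x t) &&
          [exists w' in D, (w' \in den x u) && bin R w w']])
  | Defs.Mem _ _ t j => fun x X => [exists w in D, (w \in den x t) && (w \in tnth X j)]
  | Not _ _ g => fun x X => ctype_of g x X
  | And _ _ g h => fun x X => (ctype_of g x X, ctype_of h x X)
  | Exists _ _ g => fun x X =>
      ([set ctype_of g [tuple of [set y] :: x] X | y in D], ctype_of g [tuple of set0 :: x] X)
  | ExistsSet _ _ g => fun x X =>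
      [set ctype_of g x [tuple of Y :: X] | Y in [set: T]]
  | Count _ _ m _ m_gt0 g => fun x X =>
      ([ffun t => Ordinal (ltn_pmod
          #|[set y in D | ctype_of g [tuple of [set y] :: x] X == t]| m_gt0)],
       ctype_of g [tuple of set0 :: x] X)
  end.
End CType.

(** Meant for the block that is the whole structure, so the components for a point outside the block
    are not read. *)
Fixpoint dec p q (f : formula tau p q) : ctype f -> bool :=
  match f in formula _ p q return ctype f -> bool with
  | Eq _ _ _ _ | Unary _ _ _ _ | Defs.Mem _ _ _ _ => id
  | Binary _ _ _ _ _ => fun a => a.2
  | Not _ _ g => fun a => ~~ @dec _ _ g a
  | And _ _ g h => fun a => @dec _ _ g a.1 && @dec _ _ h a.2
  | Exists _ _ g => fun a => [exists t in a.1, @dec _ _ g t]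
  | ExistsSet _ _ g => fun a => [exists t in a, @dec _ _ g t]
  | Count _ _ m r _ g => fun a => \sum_(t | @dec _ _ g t) a.1 t == r %[mod m]
  end.

Definition rs_of (S : structure tau) : rstruct :=
  @RStruct (universe S) (fun c => pred1 (const_of S c))
    (fun P w => w \in unary_of S P) (fun R w w' => (w, w') \in binary_of S R).

Lemma den_map_set1 (S : structure tau) p (x : p.-tuple (universe S)) t :
  den (W := rs_of S) (map_tuple set1 x) t = [set eval x t].
Proof.
case: t => [i|c] /=; first by rewrite tnth_map.
by apply/setP=> w; rewrite !inE.
Qed.

Lemma map_tuple_cons (A B : Type) (h : A -> B) n (x : n.-tuple A) y :
  map_tuple h [tuple of y :: x] = [tuple of h y :: map_tuple h x].
Proof. exact: val_inj. Qed.

Lemma card_sum_classes (I J : finType) (P : pred I) (Q : pred J) (h : I -> J) :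
  #|[set i | P i && Q (h i)]| = \sum_(j | Q j) #|[set i | P i & h i == j]|.
Proof.
rewrite -sum1_card (partition_big h Q) /=; last by move=> i; rewrite inE => /andP[].
apply: eq_bigr => j Qj; rewrite -sum1_card; apply: eq_bigl => i.
by rewrite !inE; case: eqP => [->|]; rewrite ?andbF // Qj andbT.
Qed.

Lemma sat_dec (S : structure tau) p q (f : formula tau p q)
    (x : p.-tuple (universe S)) (X : q.-tuple {set universe S}) :
  sat f x X = dec (@ctype_of (rs_of S) setT p q f (map_tuple set1 x) X).
Proof.
elim: f x X => {p q} /=.
- move=> p q t u x X; rewrite !den_map_set1.
  apply/eqP/existsP => [->|[w]]; first by exists (eval x u); rewrite !inE eqxx.
  by rewrite !inE /= => /andP[/eqP <- /eqP].
- move=> p q P t x X; rewrite !den_map_set1.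
  apply/idP/existsP => [H|[w]]; first by exists (eval x t); rewrite !inE eqxx.
  by rewrite !inE /= => /andP[/eqP ->].
- move=> p q P t u x X; rewrite !den_map_set1.
  apply/idP/existsP => [H|[w]].
    exists (eval x t); rewrite !inE eqxx /=.
    by apply/existsP; exists (eval x u); rewrite !inE eqxx.
  rewrite !inE /= => /andP[/eqP -> /existsP[w']].
  by rewrite !inE /= => /andP[/eqP ->].
- move=> p q t j x X; rewrite !den_map_set1.
  apply/idP/existsP => [H|[w]]; first by exists (eval x t); rewrite !inE eqxx.
  by rewrite !inE /= => /andP[/eqP ->].
- by move=> p q g IH x X; rewrite IH.
- by move=> p q g IHg h IHh x X; rewrite IHg IHh.
- move=> p q g IH x X.
  apply/existsP/existsP => [[y]|[t /andP[/imsetP[y _ ->]]]].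
    rewrite IH map_tuple_cons => H; eexists; apply/andP; split; last exact: H.
    by apply: imset_f; rewrite inE.
  by move=> H; exists y; rewrite IH map_tuple_cons.
- move=> p q g IH x X.
  apply/existsP/existsP => [[Y]|[t /andP[/imsetP[Y _ ->]]]].
    rewrite IH => H; eexists; apply/andP; split; last exact: H.
    by apply: imset_f; rewrite inE.
  by move=> H; exists Y; rewrite IH.
- move=> p q m r m_gt0 g IH x X.
  under eq_bigr do rewrite ffunE /=.
  congr (_ == _); rewrite modn_summ; congr (_ %% _).
  rewrite (eq_bigr (fun t => #|[set y : universe S | true &
     @ctype_of (rs_of S) setT p.+1 q g [tuple of [set y] :: map_tuple set1 x] X == t]|)).
    rewrite -(card_sum_classes xpredT (@dec _ _ g)); apply: eq_card => y.
    by rewrite !inE IH map_tuple_cons.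
  by move=> t _; apply: eq_card => y; rewrite !inE.
Qed.

(** [ctype_of] inspects points of [D] only, so [h] has to respect the structure on [D] alone; a
    block can thus be compared with its copy inside a larger structure. *)
Lemma ctype_iso (W W' : rstruct) (h : carrier W -> carrier W') (D : {set carrier W}) :
  {in D &, injective h} ->
  (forall c, {in D, forall w, cst c (h w) = cst c w}) ->
  (forall P, {in D, forall w, una P (h w) = una P w}) ->
  (forall R, {in D &, forall w w', bin R (h w) (h w') = bin R w w'}) ->
  forall p q (f : formula tau p q) (x : p.-tuple {set carrier W})
    (x' : p.-tuple {set carrier W'}) (X : q.-tuple {set carrier W}) (X' : q.-tuple {set carrier W'}),
  (forall i, {in D, forall w, (h w \in tnth x' i) = (w \in tnth x i)}) ->
  (forall i, {in D, forall w, (h w \in tnth X' i) = (w \in tnth X i)}) ->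
  ctype_of (h @: D) f x' X' = ctype_of D f x X.
Proof.
move=> h_inj hc hP hR.
have ex_im (Q : pred (carrier W')) (Q' : pred (carrier W)) :
    {in D, forall w, Q (h w) = Q' w} ->
    [exists w in h @: D, Q w] = [exists w in D, Q' w].
  move=> QQ; apply/existsP/existsP => [[w' /andP[/imsetP[w Dw ->]]]|[w /andP[Dw Qw]]].
    by rewrite QQ // => Qw; exists w; rewrite Dw.
  by exists (h w); rewrite imset_f // QQ.
have hden p (x : p.-tuple {set carrier W}) (x' : p.-tuple {set carrier W'}) (t : term tau p) :
    (forall i, {in D, forall w, (h w \in tnth x' i) = (w \in tnth x i)}) ->
    {in D, forall w, (h w \in den x' t) = (w \in den x t)}.
  by move=> hx w Dw; case: t => [i|c] /=; [apply: hx | rewrite !inE hc].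
have hcons n (x : n.-tuple {set carrier W})
    (x' : n.-tuple {set carrier W'}) (y : {set carrier W}) (y' : {set carrier W'}) :
    (forall i, {in D, forall w, (h w \in tnth x' i) = (w \in tnth x i)}) ->
    {in D, forall w, (h w \in y') = (w \in y)} ->
    forall i, {in D, forall w, (h w \in tnth [tuple of y' :: x'] i) =
       (w \in tnth [tuple of y :: x] i)}.
  move=> hx hy i w Dw; case: (unliftP ord0 i) => [j|] ->; last by rewrite !tnth0 hy.
  by rewrite !tnthS hx.
have h0 : {in D, forall w, (h w \in (set0 : {set carrier W'})) =
                           (w \in (set0 : {set carrier W}))}.
  by move=> w; rewrite !inE.
have h1 y : y \in D -> {in D, forall w, (h w \in [set h y]) = (w \in [set y])}.
  by move=> Dy w Dw; rewrite !inE; apply/eqP/eqP => [/h_inj|] -> //.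
move=> p q f; elim: f => {p q} /=.
- move=> p q t u x x' X X' hx hX; apply: (ex_im) => w Dw.
  by rewrite !(hden _ _ _ _ hx).
- move=> p q P t x x' X X' hx hX; apply: (ex_im) => w Dw.
  by rewrite !(hden _ _ _ _ hx) // hP.
- move=> p q R t u x x' X X' hx hX; congr (_, _, _).
  + by apply: (ex_im) => w Dw; rewrite !(hden _ _ _ _ hx).
  + by apply: (ex_im) => w Dw; rewrite !(hden _ _ _ _ hx).
  apply: (ex_im) => w Dw; rewrite !(hden _ _ _ _ hx) //; congr andb.
  by apply: (ex_im) => w' Dw'; rewrite !(hden _ _ _ _ hx) // hR.
- move=> p q t j x x' X X' hx hX; apply: (ex_im) => w Dw.
  by rewrite !(hden _ _ _ _ hx) // hX.
- by move=> p q g IH x x' X X' hx hX; apply: IH.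
- by move=> p q g IHg k IHk x x' X X' hx hX; rewrite (IHg x _ X) // (IHk x _ X).
- move=> p q g IH x x' X X' hx hX; congr (_, _); last by apply: IH => //; apply: hcons.
  rewrite -imset_comp; apply: eq_in_imset => y Dy /=.
  by apply: IH => //; apply: hcons => //; apply: h1.
- move=> p q g IH x x' X X' hx hX.
  (* Set variables range over the whole carrier but count only through their traces: a preimage
     serves one way, the image of the trace on [D] the other. *)
  apply/setP=> t; apply/imsetP/imsetP => [[Y' _ ->]|[Y _ ->]].
    exists (h @^-1: Y'); rewrite ?inE //; apply: IH => //; apply: hcons => // w Dw.
    by rewrite inE.
  exists (h @: (D :&: Y)); rewrite ?inE //; apply/esym/IH => //; apply: hcons => // w Dw.
  apply/imsetP/idP => [[w']|Yw]; last by exists w; rewrite // inE Dw.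
  by rewrite inE => /andP[Dw' Yw'] /h_inj ->.
- move=> p q m r m_gt0 g IH x x' X X' hx hX.
  congr (_, _); last by apply: IH => //; apply: hcons.
  apply/ffunP=> t; rewrite !ffunE; apply: val_inj => /=; congr (_ %% _).
  rewrite -(card_in_imset (f := h)); last first.
    by move=> y y'; rewrite !inE => /andP[Dy _] /andP[Dy' _]; apply: h_inj.
  have E y : y \in D -> ctype_of (h @: D) g [tuple of [set h y] :: x'] X' =
                        ctype_of D g [tuple of [set y] :: x] X.
    by move=> Dy; apply: IH => //; apply: hcons => //; apply: h1.
  apply: eq_card => y'; rewrite inE; apply/andP/imsetP.
    by case=> /imsetP[y Dy ->]; rewrite E // => H; exists y; rewrite // inE Dy.
  by case=> y; rewrite inE => /andP[Dy H] ->; rewrite imset_f // E.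
Qed.

Lemma ctype_local (W : rstruct) (D : {set carrier W}) p q (f : formula tau p q)
    (x x' : p.-tuple {set carrier W}) (X X' : q.-tuple {set carrier W}) :
  (forall i, {in D, tnth x' i =i tnth x i}) ->
  (forall i, {in D, tnth X' i =i tnth X i}) ->
  ctype_of D f x' X' = ctype_of D f x X.
Proof. by move=> hx hX; rewrite -{1}(imset_id D); apply: ctype_iso. Qed.

(** * Composition of blocks, after Feferman and Vaught *)

Definition cross (V : finType) (A : bsym -> rel V) (W : rstruct)
    (D : {set carrier W}) (pi : carrier W -> V) : Prop :=
  forall R, {in D &, forall w w', pi w != pi w' ->
    bin R w w' = A R (pi w) (pi w')}.

Definition fib (V : finType) (W : rstruct) (D : {set carrier W}) (pi : carrier W -> V) v :=
  [set w in D | pi w == v].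

Lemma ex_fib (V : finType) (W : rstruct) (D : {set carrier W}) (pi : carrier W -> V) (Q : pred (carrier W)) :
  [exists w in D, Q w] = [exists v, [exists w in fib D pi v, Q w]].
Proof.
apply/existsP/existsP => [[w /andP[Dw Qw]]|[v /existsP[w /andP[]]]].
  by exists (pi w); apply/existsP; exists w; rewrite inE Dw eqxx.
by rewrite inE => /andP[Dw _] Qw; exists w; rewrite Dw.
Qed.

(** The singleton misses the fibre over [v], where it has the same trace as the empty set. *)
Lemma ctype_fib_cons (V : finType) (W : rstruct) (D : {set carrier W}) (pi : carrier W -> V) p q
    (g : formula tau p.+1 q) (x : p.-tuple {set carrier W})
    (X : q.-tuple {set carrier W}) y v :
  pi y != v ->
  ctype_of (fib D pi v) g [tuple of [set y] :: x] X =
  ctype_of (fib D pi v) g [tuple of set0 :: x] X.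
Proof.
move=> yv; apply: ctype_local => // i w; rewrite inE => /andP[_ /eqP wv].
case: (unliftP ord0 i) => [j|] ->; first by rewrite !tnthS.
by rewrite !tnth0 !inE; apply: contraNF yv => /eqP <-; apply/eqP.
Qed.

(** A related pair lies in one block or in two distinct ones; in the second case [A] decides, and it
    is enough to know which blocks contain the values of the terms. *)
Lemma ctype_comp_ex (V : finType) (A : bsym -> rel V) (W : rstruct) (D : {set carrier W})
    (pi : carrier W -> V) p (x : p.-tuple {set carrier W}) R t u :
  cross A D pi ->
  [exists w in D, (w \in den x t) && [exists w' in D, (w' \in den x u) && bin R w w']]
  = [exists v, [exists w in fib D pi v, (w \in den x t) &&
         [exists w' in fib D pi v, (w' \in den x u) && bin R w w']]]
  || [exists v, [exists v', (v != v') && [&& [exists w in fib D pi v, w \in den x t],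
       [exists w in fib D pi v', w \in den x u] & A R v v']]].
Proof.
move=> hA; apply/idP/orP.
  case/existsP=> w /and3P[Dw tw /existsP[w' /and3P[Dw' uw' Rww']]].
  case: (eqVneq (pi w) (pi w')) => ww'; [left|right].
    apply/existsP; exists (pi w); apply/existsP; exists w.
    rewrite inE Dw eqxx tw /=; apply/existsP; exists w'.
    by rewrite inE Dw' ww' eqxx uw'.
  apply/existsP; exists (pi w); apply/existsP; exists (pi w').
  rewrite ww' /= -hA // Rww' andbT; apply/andP.
  by split; apply/existsP; [exists w|exists w']; rewrite inE ?Dw ?Dw' eqxx.
case.
  case/existsP=> v /existsP[w]; rewrite inE.
  case/and3P=> /andP[Dw _] tw /existsP[w']; rewrite inE.
  case/and3P=> /andP[Dw' _] uw' Rww'.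
  apply/existsP; exists w; rewrite Dw tw; apply/existsP; exists w'.
  by rewrite Dw' uw'.
case/existsP=> v /existsP[v' /and4P[vv' /existsP[w]]].
rewrite inE => /andP[/andP[Dw /eqP wv] tw] /existsP[w'].
rewrite inE => /andP[/andP[Dw' /eqP wv'] uw'] AR.
apply/existsP; exists w; rewrite Dw tw; apply/existsP; exists w'.
by rewrite Dw' uw' hA ?wv ?wv'.
Qed.

(** Induction on the formula: a witness on one side is replaced, block by block, by one of the same
    type on the other. Both structures vary in the induction, since counting also compares two
    points of the same structure. *)
Lemma ctype_comp (V : finType) (A : bsym -> rel V) p q (f : formula tau p q)
    (W W' : rstruct) (D : {set carrier W}) (D' : {set carrier W'})
    (pi : carrier W -> V) (pi' : carrier W' -> V)
    (x : p.-tuple {set carrier W}) (x' : p.-tuple {set carrier W'})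
    (X : q.-tuple {set carrier W}) (X' : q.-tuple {set carrier W'}) :
  cross A D pi -> cross A D' pi' ->
  (forall v, ctype_of (fib D pi v) f x X = ctype_of (fib D' pi' v) f x' X') ->
  ctype_of D f x X = ctype_of D' f x' X'.
Proof.
elim: f W W' D D' pi pi' x x' X X' => {p q} /=.
- by move=> p q t u W W' D D' pi pi' x x' X X' hA hA' H; rewrite !(ex_fib _ pi) !(ex_fib _ pi'); apply: eq_existsb.
- by move=> p q P t W W' D D' pi pi' x x' X X' hA hA' H; rewrite !(ex_fib _ pi) !(ex_fib _ pi'); apply: eq_existsb.
- move=> p q R t u W W' D D' pi pi' x x' X X' hA hA' H.
  have Ht v : [exists w in fib D pi v, w \in den x t] = [exists w in fib D' pi' v, w \in den x' t].
    by case: (H v).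
  have Hu v : [exists w in fib D pi v, w \in den x u] = [exists w in fib D' pi' v, w \in den x' u].
    by case: (H v).
  congr (_, _, _).
  + by rewrite (ex_fib _ pi) (ex_fib _ pi'); apply: eq_existsb.
  + by rewrite (ex_fib _ pi) (ex_fib _ pi'); apply: eq_existsb.
  rewrite (ctype_comp_ex _ _ _ _ hA) (ctype_comp_ex _ _ _ _ hA'); congr (_ || _).
    by apply: eq_existsb => v; case: (H v).
  by apply: eq_existsb => v; apply: eq_existsb => v'; rewrite Ht Hu.
- by move=> p q t j W W' D D' pi pi' x x' X X' hA hA' H; rewrite !(ex_fib _ pi) !(ex_fib _ pi'); apply: eq_existsb.
- by move=> p q g IH W W' D D' pi pi' x x' X X' hA hA' H; apply: IH.
- move=> p q g IHg k IHk W W' D D' pi pi' x x' X X' hA hA' H.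
  by rewrite (IHg W W' D D' pi pi' x x' X X') ?(IHk W W' D D' pi pi' x x' X X') // => v;
     case: (H v).
- move=> p q g IH W W' D D' pi pi' x x' X X' hA hA' H.
  have E (Z Z' : rstruct) (F : {set carrier Z}) (F' : {set carrier Z'})
      (rho : carrier Z -> V) (rho' : carrier Z' -> V)
      (z : p.-tuple {set carrier Z}) (z' : p.-tuple {set carrier Z'})
      (U : q.-tuple {set carrier Z}) (U' : q.-tuple {set carrier Z'}) :
    cross A F rho -> cross A F' rho' ->
    (forall v, ctype_of (fib F rho v) (Exists g) z U = ctype_of (fib F' rho' v) (Exists g) z' U') ->
    {subset [set ctype_of F g [tuple of [set y] :: z] U | y in F] <=
       [set ctype_of F' g [tuple of [set y] :: z'] U' | y in F']}.
    move=> FA FA' HF t /imsetP[y Fy ->].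
    have [Hs _] := HF (rho y).
    have : ctype_of (fib F rho (rho y)) g [tuple of [set y] :: z] U \in
       [set ctype_of (fib F' rho' (rho y)) g [tuple of [set y'] :: z'] U' | y' in fib F' rho' (rho y)].
      by rewrite -Hs; apply/imsetP; exists y; rewrite // inE Fy eqxx.
    (* The new witness lies over the same vertex as [y]; over every other vertex both are absent. *)
    case/imsetP=> y'; rewrite inE => /andP[Fy' /eqP yy'] Ey.
    apply/imsetP; exists y' => //; apply: (IH) => // v.
    case: (eqVneq (rho y) v) => [<- //|yv].
    by rewrite !ctype_fib_cons ?yy' //; case: (HF v).
  congr (_, _).
    apply/eqP; rewrite eqEsubset; apply/andP; split; apply/subsetP.
      exact: E.
    by apply: E => // v; exact/esym/H.
  by apply: (IH) => // v; case: (H v).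
- move=> p q g IH W W' D D' pi pi' x x' X X' hA hA' H.
  have E (Z Z' : rstruct) (F : {set carrier Z}) (F' : {set carrier Z'})
      (rho : carrier Z -> V) (rho' : carrier Z' -> V)
      (z : p.-tuple {set carrier Z}) (z' : p.-tuple {set carrier Z'})
      (U : q.-tuple {set carrier Z}) (U' : q.-tuple {set carrier Z'}) :
    cross A F rho -> cross A F' rho' ->
    (forall v, ctype_of (fib F rho v) (ExistsSet g) z U = ctype_of (fib F' rho' v) (ExistsSet g) z' U') ->
    {subset [set ctype_of F g z [tuple of Y :: U] | Y in [set: {set carrier Z}]] <=
       [set ctype_of F' g z' [tuple of Y :: U'] | Y in [set: {set carrier Z'}]]}.
    move=> FA FA' HF t /imsetP[Y _ ->].
    have Hv v : exists Y' : {set carrier Z'}, ctype_of (fib F rho v) g z [tuple of Y :: U] ==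
        ctype_of (fib F' rho' v) g z' [tuple of Y' :: U'].
      have : ctype_of (fib F rho v) g z [tuple of Y :: U] \in
         [set ctype_of (fib F' rho' v) g z' [tuple of Y' :: U'] | Y' in [set: {set carrier Z'}]].
        by have /= <- := HF v; apply/imsetP; exists Y; rewrite ?inE.
      by case/imsetP=> Y' _ ->; exists Y'.
    (* A set is chosen over each vertex separately, and the choices are glued along the fibres. *)
    pose Yv v := xchoose (Hv v).
    apply/imsetP; exists [set w | w \in Yv (rho' w)]; rewrite ?inE //; apply: (IH) => // v.
    rewrite (eqP (xchooseP (Hv v))); apply: ctype_local => // i w.
    rewrite inE => /andP[_ /eqP wv].
    case: (unliftP ord0 i) => [j|] ->; first by rewrite !tnthS.
    by rewrite !tnth0 inE wv.
  apply/eqP; rewrite eqEsubset; apply/andP; split; apply/subsetP.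
    exact: E.
  by apply: E => // v; exact/esym/H.
- move=> p q m r m_gt0 g IH W W' D D' pi pi' x x' X X' hA hA' H.
  congr (_, _); last by apply: (IH) => // v; case: (H v).
  apply/ffunP=> t; rewrite !ffunE; apply: val_inj => /=.
  have H0 v : ctype_of (fib D pi v) g [tuple of set0 :: x] X =
              ctype_of (fib D' pi' v) g [tuple of set0 :: x'] X' by case: (H v).
  have Hc v s : #|[set y in fib D pi v | ctype_of (fib D pi v) g [tuple of [set y] :: x] X == s]|
     = #|[set y in fib D' pi' v | ctype_of (fib D' pi' v) g [tuple of [set y] :: x'] X' == s]| %[mod m].
    by have [/ffunP/(_ s)] := H v; rewrite !ffunE => /(congr1 val).
  (* Whether a point over [v] has global type [t] depends only on [v] and on its type [s] in its own
     fibre, in the same way on both sides; the disjunction makes [h] symmetric. The global counts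
     are then sums of fibre counts, which agree modulo [m]. *)
  pose h v s :=
    [exists y in fib D pi v, (ctype_of (fib D pi v) g [tuple of [set y] :: x] X == s) &&
       (ctype_of D g [tuple of [set y] :: x] X == t)] ||
    [exists y in fib D' pi' v, (ctype_of (fib D' pi' v) g [tuple of [set y] :: x'] X' == s) &&
       (ctype_of D' g [tuple of [set y] :: x'] X' == t)].
  have h1 v y : y \in fib D pi v ->
     (ctype_of D g [tuple of [set y] :: x] X == t) = h v (ctype_of (fib D pi v) g [tuple of [set y] :: x] X).
    rewrite inE => /andP[Dy /eqP yv]; rewrite /h; apply/idP/orP => [Ht|].
      by left; apply/existsP; exists y; rewrite inE Dy yv !eqxx.
    case=> /existsP[y']; rewrite inE => /and3P[/andP[Dy' /eqP yv'] /eqP Hty /eqP <-].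
      apply/eqP; apply: (IH) => // u; case: (eqVneq v u) => [<- //|vu].
      by rewrite !ctype_fib_cons ?yv ?yv'.
    apply/eqP; apply: (IH) => // u; case: (eqVneq v u) => [<- //|vu].
    by rewrite !ctype_fib_cons ?yv ?yv'.
  have h2 v y : y \in fib D' pi' v ->
     (ctype_of D' g [tuple of [set y] :: x'] X' == t) = h v (ctype_of (fib D' pi' v) g [tuple of [set y] :: x'] X').
    rewrite inE => /andP[Dy /eqP yv]; rewrite /h; apply/idP/orP => [Ht|].
      by right; apply/existsP; exists y; rewrite inE Dy yv !eqxx.
    case=> /existsP[y']; rewrite inE => /and3P[/andP[Dy' /eqP yv'] /eqP Hty /eqP <-].
      apply/eqP; apply: (IH) => // u; case: (eqVneq v u) => [<- //|vu].
      by rewrite !ctype_fib_cons ?yv ?yv'.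
    apply/eqP; apply: (IH) => // u; case: (eqVneq v u) => [<- //|vu].
    by rewrite !ctype_fib_cons ?yv ?yv'.
  have S1 : #|[set y in D | ctype_of D g [tuple of [set y] :: x] X == t]| =
     \sum_v \sum_(s | h v s)
       #|[set y in fib D pi v | ctype_of (fib D pi v) g [tuple of [set y] :: x] X == s]|.
    rewrite -sum1_card (partition_big pi xpredT) //=; apply: eq_bigr => v _.
    rewrite -(card_sum_classes (fun y => y \in fib D pi v)) -sum1_card; apply: eq_bigl => y.
    rewrite ![in LHS]inE andbAC; have := h1 v y; rewrite !inE.
    by case: (_ && _) => //= ->.
  have S2 : #|[set y in D' | ctype_of D' g [tuple of [set y] :: x'] X' == t]| =
     \sum_v \sum_(s | h v s)
       #|[set y in fib D' pi' v | ctype_of (fib D' pi' v) g [tuple of [set y] :: x'] X' == s]|.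
    rewrite -sum1_card (partition_big pi' xpredT) //=; apply: eq_bigr => v _.
    rewrite -(card_sum_classes (fun y => y \in fib D' pi' v)) -sum1_card; apply: eq_bigl => y.
    rewrite ![in LHS]inE andbAC; have := h2 v y; rewrite !inE.
    by case: (_ && _) => //= ->.
  rewrite S1 S2 -modn_summ -[RHS]modn_summ; congr (_ %% _); apply: eq_bigr => v _.
  rewrite -modn_summ -[RHS]modn_summ; congr (_ %% _); apply: eq_bigr => s _.
  exact: Hc.
Qed.
End Types.

(** * Substitution and extension counts *)

Section Frames.
Variables (tau : vocabulary) (phi : sentence tau).
Local Notation bsym := (binary_sym tau).
Local Notation rstruct := (rstruct tau).

Definition theta (B : rstruct) : ctype phi :=
  @ctype_of tau B setT 0 0 phi [tuple] [tuple].

Definition truth (B : rstruct) : bool := dec (theta B).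

Lemma theta_iso (W W' : rstruct) (h : carrier W -> carrier W') :
  injective h ->
  (forall c w, cst c (h w) = cst c w) ->
  (forall P w, una P (h w) = una P w) ->
  (forall R w w', bin R (h w) (h w') = bin R w w') ->
  @ctype_of tau W' [set h w | w in setT] 0 0 phi [tuple] [tuple] = theta W.
Proof.
move=> h_inj hc hP hR; apply: ctype_iso; [| | | | by case | by case].
- by move=> w w' _ _; apply: h_inj.
- by move=> c w _.
- by move=> P w _.
- by move=> R w w' _ _.
Qed.

(** The generalised lexicographic sum of the blocks [B v] along [A]. *)
Definition Subst (V : finType) (A : bsym -> rel V) (B : V -> rstruct) : rstruct :=
  @RStruct tau {v : V & carrier (B v)}
    (fun c w => cst c (tagged w))
    (fun P w => una P (tagged w))
    (fun R w w' => if tag w == tag w' then bin R (tagged w) (tagged_as w w')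
                   else A R (tag w) (tag w')).

Definition blk (V : finType) A (B : V -> rstruct) (w : carrier (Subst A B)) : V := tag w.

Lemma Subst_bin_same (V : finType) A (B : V -> rstruct) R v (b b' : carrier (B v)) :
  @bin tau (Subst A B) R (Tagged (fun v => carrier (B v)) b) (Tagged (fun v => carrier (B v)) b')
  = bin R b b'.
Proof. by rewrite /= eqxx tagged_asE. Qed.

(** [h] coarsens the partition into blocks, so that several vertices may be merged into one. *)
Lemma cross_Subst (V V' : finType) A A' (B : V -> rstruct) (h : V -> V') :
  (forall R v w, h v != h w -> A R v w = A' R (h v) (h w)) ->
  cross A' [set: carrier (Subst A B)] (h \o @blk V A B).
Proof.
move=> hA R w w' _ _ /= ww'; case: eqP => [tt|_]; last exact: hA.
by case/negP: ww'; rewrite /blk tt.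
Qed.

Lemma ctype_fib_tag (V : finType) A (B : V -> rstruct) v :
  @ctype_of tau (Subst A B) (fib setT (@blk V A B) v) 0 0 phi [tuple] [tuple]
  = theta (B v).
Proof.
pose h (b : carrier (B v)) : carrier (Subst A B) := Tagged (fun v => carrier (B v)) b.
rewrite -(@theta_iso (B v) (Subst A B) h) //.
- suff -> : fib setT (@blk V A B) v = [set h b | b in setT] by [].
  apply/setP=> w; rewrite !inE /=.
  apply/eqP/imsetP => [wv|[b _ ->] //].
  by case: w wv => u b /= uv; subst u; exists b; rewrite ?inE.
- by move=> b b' /eqP; rewrite /h -tag_eqE /tag_eq eqxx /= tagged_asE => /eqP.
- by move=> R w w'; rewrite Subst_bin_same.
Qed.

(** * Relations between blocks, and their counts *)

Definition frame (V : finType) := {ffun V * V -> {set bsym}}.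

Definition rel_of (V : finType) (A : frame V) : bsym -> rel V :=
  fun R v w => R \in A (v, w).

(** [Subst] does not read the diagonal; requiring it empty makes each configuration count once. *)
Definition offdiag (V : finType) (A : frame V) : bool :=
  [forall v, A (v, v) == set0].

Definition pull (V V' : finType) (h : V -> V') (A : frame V') : frame V :=
  [ffun vw => A (h vw.1, h vw.2)].

Definition holds (V : finType) (A : frame V) (B : V -> rstruct) : bool :=
  truth (Subst (rel_of A) B).

Definition free_count (V : finType) (B : V -> rstruct) (J : finType) (s : J -> V -> V) : nat :=
  #|[set A : frame V |
      [&& offdiag A, holds A B & [forall j, pull (s j) A != A]]]|.

Lemma pull_comp (V V' V'' : finType) (h : V -> V') (k : V' -> V'') A :
  pull h (pull k A) = pull (k \o h) A.
Proof. by apply/ffunP=> vw; rewrite !ffunE. Qed.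

Lemma eq_pull (V V' : finType) (h k : V -> V') A : h =1 k -> pull h A = pull k A.
Proof. by move=> hk; apply/ffunP=> vw; rewrite !ffunE !hk. Qed.

Lemma pull_id (V : finType) (A : frame V) : pull id A = A.
Proof. by apply/ffunP=> -[v w]; rewrite !ffunE. Qed.

Lemma pull_inj (V V' : finType) (h : V -> V') : bijective h -> injective (@pull _ _ h).
Proof.
case=> k hk kh A A' /(congr1 (@pull _ _ k)).
by rewrite !pull_comp !(eq_pull _ (k := id)) ?pull_id.
Qed.

Lemma pull_bij (V V' : finType) (h : V -> V') : bijective h -> bijective (@pull _ _ h).
Proof.
by case=> k hk kh; exists (@pull _ _ k) => A; rewrite pull_comp -[RHS]pull_id;
  apply: eq_pull.
Qed.

(** Both sides are cut along [V'] into fibres of equal types, so [ctype_comp] applies. *)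
Lemma holds_pull (V V' : finType) (h : V -> V') (A : frame V') B B' :
  bijective h -> (forall v, theta (B v) = theta (B' (h v))) ->
  holds (pull h A) B = holds A B'.
Proof.
move=> bh hB; congr dec; have h_inj := bij_inj bh.
apply: (@ctype_comp tau V' (rel_of A) 0 0 phi _ _ _ _ (h \o @blk _ _ B) (@blk _ _ B')).
- by apply: cross_Subst => R v w _; rewrite /rel_of ffunE.
- exact: (@cross_Subst _ _ _ _ _ id).
case: bh => k hk kh v'; rewrite ctype_fib_tag -[v']kh -hB -(ctype_fib_tag (rel_of (pull h A))).
suff -> : fib setT (h \o @blk _ _ B) (h (k v')) = fib setT (@blk _ (rel_of (pull h A)) B) (k v') by [].
by apply/setP=> w; rewrite !inE /= (inj_eq h_inj).
Qed.

Lemma offdiag_pull (V V' : finType) (h : V -> V') (A : frame V') :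
  bijective h -> offdiag (pull h A) = offdiag A.
Proof.
case=> k hk kh; apply/forallP/forallP => hA v; last by rewrite ffunE.
by have := hA (k v); rewrite ffunE /= kh.
Qed.

(** Precomposition with [h] is a bijection of configurations. The count thus depends on the blocks
    only through their types, which makes it a function of colours. *)
Lemma free_count_reindex (V V' : finType) (h : V -> V') (B : V -> rstruct) (B' : V' -> rstruct)
    (J : finType) (s : J -> V -> V) (s' : J -> V' -> V') :
  bijective h -> (forall v, theta (B v) = theta (B' (h v))) ->
  (forall j v, h (s j v) = s' j (h v)) ->
  free_count B s = free_count B' s'.
Proof.
move=> bh hB hs; have ph := pull_bij bh; have pi := pull_inj bh.
rewrite /free_count -(on_card_preimset (f := @pull _ _ h)); last exact: onW_bij.
apply: eq_card => A; rewrite !inE offdiag_pull // (holds_pull _ bh hB).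
congr [&& _, _ & _]; apply: eq_forallb => j.
have -> : pull (s j) (pull h A) = pull h (pull (s' j) A).
  by rewrite !pull_comp; apply: eq_pull => v; apply: hs.
by rewrite (inj_eq pi).
Qed.

(** * Merging a rotation-invariant group into one point *)

Section Peel.
Variable p' : nat.
Local Notation Z := 'I_p'.+2.

Definition rho (z : Z) : Z := (z + 1)%R.

Lemma Zp_ind (P : Z -> Prop) : P 0%R -> (forall z, P z -> P (rho z)) -> forall z, P z.
Proof.
move=> P0 PS z; rewrite -[z]natr_Zp.
by elim: (nat_of_ord z) => [//|n IH]; rewrite -GRing.natr1; apply: PS.
Qed.

(** The circulant structures on Z/p. *)
Definition circ (E : frame Z) : bool := offdiag E && (pull rho E == E).

Variable V : finType.
Implicit Types (A : frame (Z + V)%type) (K : frame (option V)).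

Definition Bsum (B0 : rstruct) (B : V -> rstruct) (v : Z + V) : rstruct :=
  match v with inl _ => B0 | inr v => B v end.

Definition Bopt (B0 : rstruct) (B : V -> rstruct) (v : option V) : rstruct :=
  if v is Some v then B v else B0.

Definition smap (f : Z -> Z) (g : V -> V) (v : Z + V) : Z + V :=
  match v with inl z => inl (f z) | inr v => inr (g v) end.

Definition merge (v : Z + V) : option V := if v is inr v then Some v else None.

Definition unmerge (v : option V) : Z + V := if v is Some v then inr v else inl 0%R.

Definition expand (E : frame Z) K : frame (Z + V)%type :=
  [ffun vw => if vw is (inl z, inl z') then E (z, z') else K (merge vw.1, merge vw.2)].

(** Undoes [expand]: the relations inside the group are forgotten, and 0 represents the group, any
    point being as good when the rotation fixes [A]. *)
Definition collapse A : frame (option V) :=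
  [ffun vw => if vw is (None, None) then set0 else A (unmerge vw.1, unmerge vw.2)].

Lemma expandK E K : offdiag K -> collapse (expand E K) = K.
Proof.
move=> /forallP hA; apply/ffunP=> -[[v|] [w|]]; rewrite !ffunE //.
by rewrite (eqP (hA None)).
Qed.

Lemma pull_inl_expand E K : pull inl (expand E K) = E.
Proof. by apply/ffunP=> -[z z']; rewrite !ffunE. Qed.

(** [rho] generates the rotations, so a point outside the group cannot tell the points of the group
    apart. *)
Lemma fixed_uniform A : pull (smap rho id) A = A ->
  forall z v, A (inl z, inr v) = A (inl 0%R, inr v) /\ A (inr v, inl z) = A (inr v, inl 0%R).
Proof.
move=> hA z v; elim/Zp_ind: z => [//|z [<- <-]].
by split; rewrite -[in RHS]hA ffunE.
Qed.

Lemma collapseK A : pull (smap rho id) A = A -> expand (pull inl A) (collapse A) = A.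
Proof.
move=> /fixed_uniform hA.
apply/ffunP=> -[[z|v] [z'|w]]; rewrite !ffunE //=.
  by case: (hA z w).
by case: (hA z' v).
Qed.

Lemma offdiag_expand E K : offdiag E -> offdiag K -> offdiag (expand E K).
Proof.
by move=> /forallP hE /forallP hA; apply/forallP=> -[z|v]; rewrite ffunE ?hE ?hA.
Qed.

Lemma offdiag_collapse A : offdiag A -> offdiag (collapse A).
Proof.
by move=> /forallP hA; apply/forallP=> -[v|]; rewrite ffunE // (eqP (hA (inr v))).
Qed.

Lemma pull_smap_expand E K f g :
  pull (smap f g) (expand E K) = expand (pull f E) (pull (omap g) K).
Proof. by apply/ffunP=> -[[z|v] [z'|w]]; rewrite !ffunE. Qed.

(** The copies of [B0] related by [E] form a single block of the coarser partition given by [merge],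
    to which [ctype_comp] applies. *)
Lemma holds_expand E K B0 B :
  holds (expand E K) (Bsum B0 B)
  = holds K (Bopt (Subst (rel_of E) (fun _ => B0)) B).
Proof.
set W1 := Subst (rel_of (expand E K)) (Bsum B0 B).
congr dec.
apply: (@ctype_comp tau _ (rel_of K) 0 0 phi _ _ _ _ (merge \o @blk _ _ (Bsum B0 B)) (@blk _ _ _)).
- by apply: cross_Subst => R [z|v] [z'|w] //= _; rewrite /rel_of ffunE.
- exact: (@cross_Subst _ _ _ _ _ id).
case=> [v|]; rewrite ctype_fib_tag /=.
  rewrite -(ctype_fib_tag (rel_of (expand E K)) (Bsum B0 B) (inr v)).
  suff -> : fib setT (merge \o @blk _ _ (Bsum B0 B)) (Some v) =
     fib setT (@blk _ (rel_of (expand E K)) (Bsum B0 B)) (inr v) by [].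
  by apply/setP=> w; rewrite !inE /= /blk; case: (tag w).
pose h (b : carrier (Subst (rel_of E) (fun _ => B0))) : carrier W1 :=
   Tagged (fun v => carrier (Bsum B0 B v)) (tagged b : carrier (Bsum B0 B (inl (tag b)))).
rewrite -(@theta_iso _ W1 h) //.
- suff -> : fib setT (merge \o @blk _ _ (Bsum B0 B)) None = [set h b | b in setT] by [].
  apply/setP=> w; rewrite !inE /=; apply/eqP/imsetP => [|[b _ ->] //].
  case: w => -[z|v] //= b _.
  by exists (existT (fun _ => carrier B0 : Type) z b : carrier (Subst (rel_of E) (fun _ => B0))); rewrite ?inE.
- move=> [z b] [z' b'] hbb.
  have zz : z = z' by case: (congr1 (@tag _ _) hbb).
  subst z'; congr (Tagged _ _).
  by have := congr1 (tagged_as (h (existT _ z b))) hbb; rewrite !tagged_asE.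
move=> R [z b] [z' b'] /=.
case: (eqVneq z z') => [zz|zz].
  by subst z'; rewrite eqxx !tagged_asE.
by rewrite (inj_eq (@inl_inj _ _)) (negPf zz) /rel_of ffunE.
Qed.

Lemma pull_expand_eq E A K g : offdiag K ->
  (pull (smap id g) (expand E K) == expand E K) = (pull (omap g) K == K).
Proof.
move=> oA; rewrite pull_smap_expand pull_id; apply/eqP/eqP => [/(congr1 collapse)|-> //].
rewrite !expandK //; apply/forallP=> -[v|]; rewrite ffunE /=; exact: (forallP oA).
Qed.

(** The configurations fixed by the rotation are sorted by the circulant [E] that they induce on the
    group; [expand E] is a bijection onto each class. *)
Lemma sum_free_count_circ B0 B (J : finType) (s : J -> V -> V) :
  \sum_(E | circ E) free_count (Bopt (Subst (rel_of E) (fun _ => B0)) B) (fun j => omap (s j)) =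
  #|[set A : frame (Z + V)%type | [&& offdiag A, holds A (Bsum B0 B) &
      [forall j, pull (smap id (s j)) A != A]] && (pull (smap rho id) A == A)]|.
Proof.
rewrite -[RHS]sum1_card (partition_big (fun A => pull inl A) circ) /=; last first.
  move=> A; rewrite inE => /andP[/and3P[/forallP oA _ _] /eqP fA]; apply/andP; split.
    by apply/forallP=> z; rewrite ffunE /= (eqP (oA _)).
  by rewrite -[in X in _ == X]fA !pull_comp.
apply: eq_bigr => E /andP[oE /eqP fE].
have -> : free_count (Bopt (Subst (rel_of E) (fun _ => B0)) B) (fun j => omap (s j)) =
  #|expand E @: [set A : frame (option V) |
      [&& offdiag A, holds A (Bopt (Subst (rel_of E) (fun _ => B0)) B) &
          [forall j, pull (omap (s j)) A != A]]]|.
  rewrite card_in_imset // => A K; rewrite !inE => /and3P[oA _ _] /and3P[oK _ _].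
  by move/(congr1 collapse); rewrite !expandK.
rewrite -sum1_card; apply: eq_bigl => A; apply/imsetP/andP.
  case=> K; rewrite inE => /and3P[oA hA fA] ->.
  rewrite pull_inl_expand inE offdiag_expand // holds_expand hA /=; split=> //.
  rewrite pull_smap_expand fE (eq_pull K (k := id)) ?pull_id ?eqxx ?andbT; last by case.
  by apply/forallP=> j; rewrite pull_expand_eq // (forallP fA).
rewrite inE => -[/andP[/and3P[oA hA fA] /eqP rA] /eqP EA].
have AE := collapseK rA; rewrite EA in AE.
have oK := offdiag_collapse oA.
exists (collapse A) => //; rewrite inE oK -holds_expand AE hA /=.
by apply/forallP=> j; rewrite -(pull_expand_eq E) // AE (forallP fA).
Qed.

(** The configurations on the right are split according to whether the rotation of [Z] fixes them.
    This is one factor [T_q^p - L_q]. *)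
Lemma free_count_peel B0 B (J : finType) (s : J -> V -> V) :
  free_count (Bsum B0 B) (fun j : option J => if j is Some j then smap id (s j) else smap rho id)
  + \sum_(E | circ E) free_count (Bopt (Subst (rel_of E) (fun _ => B0)) B) (fun j => omap (s j)) =
  free_count (Bsum B0 B) (fun j => smap id (s j)).
Proof.
rewrite sum_free_count_circ [RHS]/free_count -(cardsID [set A | pull (smap rho id) A == A]) addnC.
congr (_ + _); first by apply: eq_card => A; rewrite !inE.
apply: eq_card => A; rewrite !inE [RHS]andbC -!andbA; congr [&& _, _ & _].
apply/forallP/andP => [hA|[/forallP fA hA] [j|] //].
by split; [apply/forallP=> j; apply: (hA (Some j))|apply: (hA None)].
Qed.
End Peel.
End Frames.

(** * Rotating blocks of prime size *)

Section Blocks.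
Variables (tau : vocabulary) (phi : sentence tau).
Variable p' : nat.
Local Notation Z := 'I_p'.+2.
Local Notation bsym := (binary_sym tau).
Local Notation rstruct := (rstruct tau).

Section Action.
Variables (J V : finType).
Local Notation T := (J * Z + V)%type.
Local Notation gT := {dffun forall _ : J, Z}.

Definition rot (j : J) (v : T) : T :=
  match v with
  | inl (i, z) => inl (i, if i == j then rho z else z)
  | inr v => inr v
  end.

Definition shift (g : gT) (v : T) : T :=
  match v with
  | inl (i, z) => inl (i, z + g i)%R
  | inr v => inr v
  end.

Definition unit_shift (j : J) : gT := [ffun i => if i == j then 1%R else 0%R : Z].

Lemma rot_shift j : rot j =1 shift (unit_shift j).
Proof.
by case=> [[i z]|v] //=; rewrite ffunE; case: eqP => //; rewrite GRing.addr0.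
Qed.

Lemma shift1 : shift 1%g =1 id.
Proof. by case=> [[i z]|v] //=; rewrite oneg_ffun GRing.addr0. Qed.

Lemma shiftM g h v : shift (g * h)%g v = shift g (shift h v).
Proof.
case: v => [[i z]|v] //=; rewrite mulg_ffun.
by congr (inl (_, _)); rewrite -GRing.addrA [(h i + g i)%R]GRing.addrC.
Qed.

Lemma shift_bij g : bijective (shift g).
Proof.
by exists (shift g^-1%g) => v; rewrite -shiftM ?mulVg ?mulgV shift1.
Qed.

Definition frame_act (A : frame tau T) (g : gT) : frame tau T := pull (shift g) A.

Lemma frame_act1 : frame_act^~ 1%g =1 id.
Proof. by move=> A; rewrite /frame_act (eq_pull _ shift1) pull_id. Qed.

Lemma frame_actM A : act_morph frame_act A.
Proof.
by move=> g h; rewrite /frame_act pull_comp; apply: eq_pull => v; rewrite shiftM.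
Qed.

Definition frame_action := TotalAction frame_act1 frame_actM.

Definition Bblk (B0 : rstruct) (B : V -> rstruct) (v : T) : rstruct :=
  match v with inl _ => B0 | inr v => B v end.

Definition free_set (B0 : rstruct) (B : V -> rstruct) : {set frame tau T} :=
  [set A | [&& offdiag A, holds phi A (Bblk B0 B) & [forall j, pull (rot j) A != A]]].

(** All blocks of the groups are [B0], so shifts preserve truth; they commute with the rotations, so
    they preserve not being fixed by any. *)
Lemma free_set_acts B0 B : [acts [set: gT], on free_set B0 B | frame_action].
Proof.
apply/subsetP=> g _; rewrite !inE; apply/subsetP=> A; rewrite !inE /= /frame_act.
case/and3P=> oA hA /forallP fA; have bg := shift_bij g.
rewrite offdiag_pull // (holds_pull (B' := Bblk B0 B) _ bg) ?oA ?hA /=; last first.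
  by case=> [[]|].
apply/forallP=> j; apply: contra (fA j) => /eqP E; apply/eqP.
apply: (pull_inj bg); rewrite -[RHS]E !pull_comp; apply: eq_pull => v /=.
by case: v => [[i z]|v] //=; case: eqP => // _; rewrite /rho GRing.addrAC.
Qed.

(* A rotation of block [i] that agrees on [A] with the rotations of two further
   blocks fixes [A]: each binary relation only sees two points at a time, hence
   at most one block besides [i], and one of the other two rotations does not
   move that block. *)
Lemma three_rot (A : frame tau T) i j l :
  i != j -> i != l -> j != l ->
  pull (rot i) A = pull (rot j) A -> pull (rot i) A = pull (rot l) A ->
  pull (rot i) A = A.
Proof.
move=> ij il jl Ej El; apply/ffunP=> -[v w].
have fix_rot k (u : T) : (if u is inl (a, _) then a != k else true) -> rot k u = u.
  by case: u => [[a z]|u] //= /negPf ->.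
pose at_blk k (u : T) := if u is inl (a, _) then a == k else false.
have E k : pull (rot i) A = pull (rot k) A -> ~~ at_blk k v -> ~~ at_blk k w ->
    pull (rot i) A (v, w) = A (v, w).
  move=> -> vk wk; rewrite ffunE /= !fix_rot //.
    by case: (w) wk => [[]|].
  by case: (v) vk => [[]|].
case vi: (at_blk i v); last case wi: (at_blk i w).
- case wj: (at_blk j w).
    apply: (E l) => //.
      by case: (v) vi => [[a z]|u] //= /eqP ->.
    by case: (w) wj => [[a z]|u] //= /eqP ->.
  apply: (E j); rewrite ?wj //.
  by case: (v) vi => [[a z]|u] //= /eqP ->.
- case vj: (at_blk j v).
    apply: (E l) => //.
      by case: (v) vj => [[a z]|u] //= /eqP ->.
    by case: (w) wi => [[a z]|u] //= /eqP ->.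
  apply: (E j); rewrite ?vj //.
  by case: (w) wi => [[a z]|u] //= /eqP ->.
- by apply: (E i); rewrite ?vi ?wi.
Qed.

Lemma three_in_fiber (S : finType) (O : {set S}) (f : J -> S) :
  (forall j, f j \in O) -> 2 * #|O| < #|J| ->
  exists i j l, [/\ i != j, i != l, j != l, f i = f j & f i = f l].
Proof.
move=> fO OJ.
have [o oO] : exists2 o, o \in O & 2 < #|[set j | f j == o]|.
  apply/exists_inP; apply: contraLR OJ; rewrite negb_exists_in -leqNgt => /forall_inP H.
  rewrite -[#|J|]sum1_card (partition_big f (mem O)) //= mulnC -sum_nat_const.
  apply: leq_sum => o oO; rewrite sum1_card leqNgt.
  by have := H o oO; rewrite cardsE.
case/card_gt2P=> i [j [l [[]]]]; rewrite !inE => /eqP fi /eqP fj /eqP fl [ij jl li].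
by exists i, j, l; rewrite fi fj fl eq_sym [i == l]eq_sym; split; rewrite // eq_sym.
Qed.

Lemma dvdn_card_free_set k B0 B :
  prime p'.+2 -> 2 * p'.+2 ^ k <= #|J| -> p'.+2 ^ k %| #|free_set B0 B|.
Proof.
move=> p_pr kJ; rewrite -(acts_sum_card_orbit (free_set_acts B0 B)).
apply: dvdn_sum => _ /imsetP[A fA ->].
(* Orbit lengths divide the order of a p-group, so they are powers of p; one below [p'.+2 ^ k] is
   small enough for three rotations to agree on [A]. *)
have : #|orbit frame_action [set: gT] A| %| p'.+2 ^ #|J|.
  rewrite card_orbit (dvdn_trans (dvdn_indexg _ _)) // cardsT.
  by rewrite card_ffun card_ord.
case/(dvdn_pfactor _ _ p_pr) => e _ oe; rewrite oe; apply: dvdn_exp2l.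
rewrite leqNgt; apply/negP => ek.
have OJ : 2 * #|orbit frame_action [set: gT] A| < #|J|.
  by apply: leq_trans kJ; rewrite oe ltn_pmul2l // ltn_exp2l.
have mem_orb j : pull (rot j) A \in orbit frame_action [set: gT] A.
  by rewrite (eq_pull _ (rot_shift j)); apply/imsetP; exists (unit_shift j).
have [i [j [l [ij il jl Ej El]]]] := three_in_fiber mem_orb OJ.
move: fA; rewrite inE => /and3P[_ _ /forallP/(_ i)].
by rewrite (three_rot ij il jl Ej El) eqxx.
Qed.
End Action.

(** Built from [option] so that one group, [None], splits off by case analysis. *)
Fixpoint blocks (N : nat) : finType := if N is n.+1 then option (blocks n) else void.

Lemma card_blocks N : #|blocks N| = N.
Proof. by elim: N => [|N IH] /=; rewrite ?card_void // card_option IH. Qed.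

Definition block_count (N : nat) (B0 : rstruct) (V : finType) (B : V -> rstruct) : nat :=
  free_count phi (Bblk (J := blocks N) B0 B) (@rot (blocks N) V).

Lemma dvdn_block_count k N B0 (V : finType) (B : V -> rstruct) :
  prime p'.+2 -> 2 * p'.+2 ^ k <= N -> p'.+2 ^ k %| block_count N B0 B.
Proof. by move=> p_pr kN; apply: dvdn_card_free_set; rewrite ?card_blocks. Qed.

Lemma block_count_reindex N B0 (V V' : finType) (B : V -> rstruct) (B' : V' -> rstruct)
    (h : V -> V') :
  bijective h -> (forall v, theta phi (B v) = theta phi (B' (h v))) ->
  block_count N B0 B = block_count N B0 B'.
Proof.
case=> k hk kh hB; pose ext (U U' : finType) (f : U -> U') (v : blocks N * Z + U) :=
  match v with inl x => inl x | inr v => inr (f v) end.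
apply: (free_count_reindex (h := ext _ _ h)).
- by exists (ext _ _ k) => -[x|v] //=; rewrite ?hk ?kh.
- by case=> [x|v] //=.
- by move=> j [[i z]|v].
Qed.

(** [free_count_peel] for the group [None]. The rest relabels vertices: the released group becomes p
    ordinary points, the merged one a single point. *)
Lemma block_count_rec N B0 (V : finType) (B : V -> rstruct) :
  block_count N.+1 B0 B
  + \sum_(E : frame tau Z | circ E) block_count N B0 (Bopt (Subst (rel_of E) (fun _ => B0)) B)
  = block_count N B0 (Bsum (p' := p') B0 B).
Proof.
transitivity (free_count phi (Bsum B0 (Bblk (J := blocks N) B0 B))
                (fun j => smap (p' := p') id (@rot (blocks N) V j))).
  rewrite -free_count_peel; congr (_ + _).
    apply/esym.
    pose h (v : Z + (blocks N * Z + V)) : blocks N.+1 * Z + V :=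
      match v with
      | inl z => inl (None, z)
      | inr (inl (i, z)) => inl (Some i, z)
      | inr (inr v) => inr v
      end.
    pose h' (v : blocks N.+1 * Z + V) : Z + (blocks N * Z + V) :=
      match v with
      | inl (None, z) => inl z
      | inl (Some i, z) => inr (inl (i, z))
      | inr v => inr (inr v)
      end.
    apply: (free_count_reindex (h := h)).
    - by exists h' => [[z|[[i z]|v]]|[[[i|] z]|v]].
    - by case=> [z|[[i z]|v]].
    - by move=> [j|] [z|[[i z]|v]].
  apply: eq_bigr => E _; apply/esym.
  pose h (v : option (blocks N * Z + V)) : blocks N * Z + option V :=
    match v with
    | None => inr None
    | Some (inl x) => inl x
    | Some (inr v) => inr (Some v)
    end.
  pose h' (v : blocks N * Z + option V) : option (blocks N * Z + V) :=
    match v with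
    | inr None => None
    | inl x => Some (inl x)
    | inr (Some v) => Some (inr v)
    end.
  apply: (free_count_reindex (h := h)).
  - by exists h' => [[[x|v]|]|[x|[v|]]].
  - by case=> [[x|v]|].
  - by move=> j [[[i z]|v]|].
pose h (v : Z + (blocks N * Z + V)) : blocks N * Z + (Z + V) :=
  match v with
  | inl z => inr (inl z)
  | inr (inl x) => inl x
  | inr (inr v) => inr (inr v)
  end.
pose h' (v : blocks N * Z + (Z + V)) : Z + (blocks N * Z + V) :=
  match v with
  | inr (inl z) => inl z
  | inl x => inr (inl x)
  | inr (inr v) => inr (inr v)
  end.
apply: (free_count_reindex (h := h)).
- by exists h' => [[z|[x|v]]|[x|[z|v]]].
- by case=> [z|[x|v]].
- by move=> j [z|[[i z]|v]].
Qed.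

End Blocks.

(** * Linear recurrences over finite rings *)

Section LinearRecurrences.
Import GRing.Theory.
Local Open Scope ring_scope.

Definition eventually_periodic (T : Type) (u : nat -> T) : Prop :=
  exists r P, (0 < P)%N /\ forall n, (r <= n)%N -> u (n + P)%N = u n.

Lemma iter_eventually_periodic (T : finType) (f : T -> T) x :
  eventually_periodic (fun n => iter n f x).
Proof.
have /trajectP[i lt_i fi] := looping_order f x.
(* The trajectory of [x] returns to index [i] after [order] steps. *)
exists i, (fingraph.order f x - i)%N; split; first by rewrite subn_gt0.
move=> n le_in; rewrite -(subnK le_in) -addnA subnKC; last exact: ltnW.
by rewrite !iterD fi.
Qed.

Section Span.
Variables (R : finComNzRingType) (Q : finType) (f : seq Q -> R) (D : nat).
Hypothesis f_perm : forall s s', perm_eq s s' -> f s = f s'.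
Hypothesis f_rec : forall q, exists2 a : seq (R * seq Q),
  {in a, forall x, size x.2 < D}%N &
  forall s, f (nseq D q ++ s) = \sum_(x <- a) x.1 * f (x.2 ++ s).

Local Notation K := ((#|Q| * D).-bseq Q).

Definition in_span (g : seq Q -> R) : Prop :=
  exists c : {ffun K -> R}, forall s, g s = \sum_k c k * f (k ++ s).

Lemma in_span_sum (I : eqType) (r : seq I) (a : I -> R) (g : I -> seq Q -> R) :
  {in r, forall i, in_span (g i)} -> in_span (fun s => \sum_(i <- r) a i * g i s).
Proof.
elim: r => [|i r IH] gs.
  exists [ffun=> 0] => s; rewrite big_nil big1 // => k _.
  by rewrite ffunE mul0r.
have [c hc] := gs i (mem_head _ _).
have [d hd] := IH (fun j jr => gs j (mem_behead (s := i :: r) jr)).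
exists [ffun k => a i * c k + d k] => s; rewrite big_cons hc hd mulr_sumr -big_split.
by apply: eq_bigr => k _; rewrite ffunE mulrDl mulrA.
Qed.

Lemma pigeonhole_count (w : seq Q) :
  (#|Q| * D < size w)%N -> exists q, (D <= count_mem q w)%N.
Proof.
move=> sw; apply/existsP; apply: contraLR sw; rewrite negb_exists -leqNgt => /forallP cw.
have -> : size w = (\sum_q count_mem q w)%N.
  elim: w {cw} => [|x w IH] /=; first by rewrite big1.
  by rewrite big_split /= -IH (bigD1 x) //= eqxx big1 ?addn0 // => q /negPf; rewrite eq_sym => ->.
rewrite -sum_nat_const; apply: leq_sum => q _; apply: ltnW.
by rewrite ltnNge cw.
Qed.

(** Strong induction on the length: a word longer than [#|Q| * D] contains some colour at least [D]
    times, [f] is symmetric, and [f_rec] trades [D] copies for shorter words. *)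
Lemma in_span_cat w : in_span (fun s => f (w ++ s)).
Proof.
elim: {w}_.+1 {-2}w (ltnSn (size w)) => // n IH w; rewrite ltnS => wn.
case: (leqP (size w) (#|Q| * D)) => [wK|/pigeonhole_count[q qw]].
  exists [ffun k => (k == Bseq wK)%:R] => s.
  rewrite (bigD1 (Bseq wK)) //= ffunE eqxx mul1r big1 ?addr0 // => k /negPf kw.
  by rewrite ffunE kw mul0r.
pose w' := nseq (count_mem q w - D) q ++ filter (predC (pred1 q)) w.
have ww' : perm_eq w (nseq D q ++ w').
  rewrite perm_sym catA -nseqD subnKC //.
  have -> : nseq (count_mem q w) q = filter (pred1 q) w.
    by rewrite -size_filter; apply/esym/all_pred1P; apply: filter_all.
  by rewrite perm_filterC.
have [a aD ha] := f_rec q.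
have [|c hc] := @in_span_sum _ a (fun x => x.1) (fun x s => f ((x.2 ++ w') ++ s)).
  move=> x xa; apply: IH; apply: leq_trans wn.
  by rewrite (perm_size ww') !size_cat size_nseq ltn_add2r aD.
exists c => s; rewrite -hc (f_perm (s' := nseq D q ++ (w' ++ s))) ?ha.
  by apply: eq_bigr => x _; rewrite catA.
by rewrite catA perm_cat2r.
Qed.

Variables (X Y : finType) (col : X -> Q) (tail : Y -> seq Q).

Lemma big_tuple_cons n (F : n.+1.-tuple X -> R) :
  \sum_t F t = \sum_x \sum_(t : n.-tuple X) F [tuple of x :: t].
Proof.
rewrite pair_big /=.
rewrite (reindex (fun xt : X * n.-tuple X => [tuple of xt.1 :: xt.2])) //=.
exists (fun t : n.+1.-tuple X => (thead t, [tuple of behead t])) => [[x t]|t] _ /=.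
  by congr (_, _); apply: val_inj.
by rewrite [RHS]tuple_eta; apply: val_inj.
Qed.

(** [t] will give the data of the n points without constants, and [y] the data of the constants. *)
Definition weight n (g : seq Q -> R) : R :=
  \sum_(t : n.-tuple X) \sum_y g ([seq col x | x <- t] ++ tail y).

(** The weights of the shifts of [f] by the words of [K] form a vector in a finite set, and the
    linear map [step] takes the vector at n to the one at n + 1. *)
Lemma weight_eventually_periodic : eventually_periodic (weight^~ f).
Proof.
(* A word of [K] followed by one more colour may leave [K]; its expansion over [K] supplies a row of
   [step]. *)
have /fin_all_exists[c hc] (kx : K * X) : exists c : {ffun K -> R},
    forall s, f ((kx.1 ++ [:: col kx.2]) ++ s) = \sum_k c k * f (k ++ s).
  exact: in_span_cat.
pose step (v : {ffun K -> R}) : {ffun K -> R} :=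
  [ffun k => \sum_x \sum_k' c (k, x) k' * v k'].
pose v n : {ffun K -> R} := [ffun k : K => weight n (fun s => f (k ++ s))].
have vE n : v n = iter n step (v 0%N).
  elim: n => //= n <-; apply/ffunP=> k; rewrite !ffunE /weight big_tuple_cons.
  apply: eq_bigr => x _; under [RHS]eq_bigr do rewrite ffunE mulr_sumr.
  rewrite [RHS]exchange_big; apply: eq_bigr => t _ /=.
  under [RHS]eq_bigr do rewrite mulr_sumr.
  rewrite [RHS]exchange_big; apply: eq_bigr => y _ /=.
  by rewrite -(hc (k, x)) /= -catA.
have [r [P [P0 hP]]] := iter_eventually_periodic step (v 0%N).
have wE n : weight n f = v n (Bseq (isT : size (Nil Q) <= #|Q| * D)%N).
  by rewrite ffunE.
by exists r, P; split=> // n rn; rewrite !wE (vE n) (vE (n + P)%N) hP.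
Qed.
End Span.

(** Expansion of [(T_q^p - L_q)^N]: taking [T_q^p] in every factor gives [p * N] letters, while each
    [L_q] adds one letter in place of [p], whence the strict bound. *)
Lemma rec_pow (R : finComNzRingType) (Q C : finType) (q : Q) (r : C -> Q) (P : pred C)
    (p : nat) (fam : nat -> seq Q -> R) :
  (1 < p)%N ->
  (forall N s, fam N.+1 s = fam N (nseq p q ++ s) - \sum_(E | P E) fam N (r E :: s)) ->
  forall N, exists2 a : seq (R * seq Q), {in a, forall x, size x.2 < p * N}%N &
    forall s, fam N s = fam 0%N (nseq (p * N) q ++ s) - \sum_(x <- a) x.1 * fam 0%N (x.2 ++ s).
Proof.
move=> p1 hfam; elim=> [|N [a aN ha]].
  by exists [::] => [//|s]; rewrite muln0 big_nil subr0.
(* In order: the old lower terms under [T_q^p], the old leading term under [L_q], and the old lower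
   terms under [L_q] with the sign reversed. *)
exists ([seq (x.1, x.2 ++ nseq p q) | x <- a] ++
        [seq (1, nseq (p * N) q ++ [:: r E]) | E <- enum P] ++
        [seq (- x.1, x.2 ++ [:: r E]) | E <- enum P, x <- a]).
  move=> x; rewrite !mem_cat mulnS => /or3P[/mapP[y /aN ya ->]|/mapP[E _ ->]|].
  - by rewrite /= size_cat size_nseq addnC ltn_add2l.
  - by rewrite /= size_cat size_nseq addnC ltn_add2r.
  - case/allpairsP=> -[E y] /= [_ /aN ya ->] /=; rewrite size_cat addnC /=.
    by rewrite -addnS leq_add // ltnW.
move=> s; rewrite hfam ha mulnS addnC nseqD -catA -!addrA; congr (_ + _).
rewrite -opprD; congr (- _); rewrite !big_cat !big_map /= big_allpairs_dep /=.
congr (_ + _); first by apply: eq_bigr => x _; rewrite -catA.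
under eq_bigr do rewrite ha.
rewrite big_split /= !big_enum_cond /=; congr (_ + _).
  by apply: eq_big => [E|E _]; [rewrite andbT|rewrite mul1r -catA].
apply: eq_big => [E|E _]; [by rewrite andbT|rewrite -sumrN]; apply: eq_bigr => x _.
by rewrite mulNr -catA.
Qed.
End LinearRecurrences.

(** * Counts indexed by sequences of colours *)

Lemma perm_bij (V : finType) (T : eqType) (c : V -> T) (s : seq T) :
  perm_eq [seq c v | v <- enum V] s ->
  exists2 h : V -> 'I_(size s), bijective h & forall v, c v = tnth (in_tuple s) (h v).
Proof.
move=> cs; have sV : #|V| = size s by rewrite -(perm_size cs) size_map -cardE.
have /tuple_permP[p hp] : perm_eq [seq c v | v <- enum V] (in_tuple s) by [].
pose h v := p (cast_ord sV (enum_rank v)); exists h.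
  apply: inj_card_bij; last by rewrite card_ord sV.
  by move=> v w /perm_inj/cast_ord_inj/enum_rank_inj.
move=> v; rewrite -(tnth_mktuple (fun i => tnth (in_tuple s) (p i))).
rewrite (tnth_nth (c v)) -hp /= (nth_map v) ?nth_enum_rank //.
by rewrite -cardE.
Qed.

Lemma map_enum_sum (A B : finType) (T : Type) (f : A + B -> T) :
  [seq f v | v <- enum {: A + B}] =
  [seq f (inl a) | a <- enum A] ++ [seq f (inr b) | b <- enum B].
Proof. by rewrite !enumT [in LHS]unlock map_cat -!map_comp. Qed.

Lemma map_enum_option (A : finType) (T : Type) (f : option A -> T) :
  [seq f v | v <- enum {: option A}] = f None :: [seq f (Some a) | a <- enum A].
Proof. by rewrite !enumT [in LHS]unlock /= -map_comp. Qed.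

Lemma map_cst (A T : Type) (x : T) (s : seq A) : [seq x | _ <- s] = nseq (size s) x.
Proof. by elim: s => //= a s ->. Qed.

Section Colours.
Variables (tau : vocabulary) (phi : sentence tau).
Local Notation Q := (ctype phi).
Local Notation rstruct := (rstruct tau).
Local Notation theta := (@theta tau phi).

Definition empty_rs : rstruct :=
  @RStruct tau void (fun _ _ => false) (fun _ _ => false) (fun _ _ _ => false).

(* A colour that is the type of no block is represented by the empty block, so
   [theta (rep q) = q] may fail. *)
Definition rep (q : Q) : rstruct :=
  if pselect (exists B, theta B = q) is left ex then projT1 (cid ex) else empty_rs.

Lemma theta_rep B : theta (rep (theta B)) = theta B.
Proof.
rewrite /rep; case: pselect => [ex|[]]; last by exists B.
by case: (cid ex).
Qed.

Definition rep_seq (s : seq Q) (i : 'I_(size s)) : rstruct :=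
  rep (tnth (in_tuple s) i).

Variable p' : nat.
Local Notation p := p'.+2.
Local Notation Z := 'I_p.

(** Equal multisets of types are matched by a bijection of vertices. The right side has
    [theta (rep q)] rather than [q] to allow for colours of no block. *)
Lemma block_count_rep N B0 (V : finType) (B : V -> rstruct) (s : seq Q) :
  perm_eq [seq theta (B v) | v <- enum V] [seq theta (rep q) | q <- s] ->
  block_count phi p' N B0 B = block_count phi p' N B0 (@rep_seq s).
Proof.
case/perm_bij=> h bh hB.
have sm : size [seq theta (rep q) | q <- s] = size s by rewrite size_map.
apply: (@block_count_reindex _ phi p' N B0 _ _ _ _ (cast_ord sm \o h)).
  by apply: bij_comp => //; exists (cast_ord (esym sm)) => i; rewrite ?cast_ordK ?cast_ordKV.
move=> v; rewrite hB /rep_seq /=.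
move: (h v) => i; case: s i {h bh hB} sm => [|q s] i sm; first by case: i.
rewrite (tnth_nth (theta (rep q))) (tnth_nth q) /=.
by rewrite -(nth_map q (theta (rep q)) (fun q => theta (rep q)) (s := q :: s)) // -sm.
Qed.

(** The value of [(T_q^p - L_q)^N f] at [s]. *)
Definition fam N q (s : seq Q) : nat := block_count phi p' N (rep q) (@rep_seq s).

Lemma theta_rep_seq (s : seq Q) :
  [seq theta (@rep_seq s i) | i <- enum 'I_(size s)] = [seq theta (rep q) | q <- s].
Proof.
transitivity [seq theta (rep q) | q <- [seq tnth (in_tuple s) i | i <- enum 'I_(size s)]].
  by rewrite -map_comp; apply: eq_map.
by rewrite map_tnth_enum.
Qed.

Definition glue (q : Q) (E : frame tau Z) : Q := theta (Subst (rel_of E) (fun _ => rep q)).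

Lemma fam_rec N q s :
  fam N.+1 q s + \sum_(E | circ E) fam N q (glue q E :: s) = fam N q (nseq p q ++ s).
Proof.
rewrite {3}/fam -(@block_count_rep _ _ _ (Bsum (p' := p') (rep q) (@rep_seq s))); last first.
  by rewrite map_enum_sum (map_cst (theta (rep q)) (enum Z)) -cardE card_ord map_cat map_nseq theta_rep_seq.
rewrite -block_count_rec; congr (_ + _); apply: eq_bigr => E _; apply/esym/block_count_rep.
by rewrite map_enum_option /= theta_rep theta_rep_seq.
Qed.

Lemma fam_perm N q s s' : perm_eq s s' -> fam N q s = fam N q s'.
Proof. by move=> ss'; apply: block_count_rep; rewrite theta_rep_seq perm_map. Qed.

Definition ext_count (V : finType) (B : V -> rstruct) : nat :=
  #|[set A : frame tau V | offdiag A && holds phi A B]|.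

(** Without groups there is no rotation to avoid, and [B0] does not occur. *)
Lemma block_count0 B0 (V : finType) (B : V -> rstruct) : block_count phi p' 0 B0 B = ext_count B.
Proof.
have -> : ext_count B = free_count phi B (fun j : void => match j with end).
  apply: eq_card => A; rewrite !inE; congr (_ && _).
  by rewrite -[LHS]andbT; congr (_ && _); apply/esym/forallP; case.
apply/esym/(free_count_reindex (h := inr)) => //.
by exists (fun v : blocks 0 * Z + V => match v with inl (i, _) => match i with end | inr v => v end)
  => // -[[[]]|].
Qed.

Lemma ext_count_rep (V : finType) (B : V -> rstruct) (s : seq Q) :
  perm_eq [seq theta (B v) | v <- enum V] [seq theta (rep q) | q <- s] ->
  ext_count B = ext_count (@rep_seq s).
Proof. by move=> Bs; rewrite -!(block_count0 empty_rs); apply: block_count_rep. Qed.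
End Colours.

(** * Counting structures *)

Section Counting.
Variables (tau : vocabulary) (phi : sentence tau).
Local Notation l := (nconst tau).
Local Notation Q := (ctype phi).
Local Notation X := ({set unary_sym tau} * {set binary_sym tau})%type.
Local Notation theta := (@theta tau phi).

(** [x] lists the unary predicates and the loops of the point, [k] the constants placed on it. *)
Definition point (k : pred 'I_l) (x : X) : rstruct tau :=
  @RStruct tau unit (fun c _ => k c) (fun P _ => P \in x.1) (fun R _ _ => R \in x.2).

Section Universe.
Variable n : nat.
Local Notation V := 'I_(n + l).
Local Notation interp := (unary_interp tau V * binary_interp tau V)%type.

Definition points (d : {ffun V -> X}) (v : V) : rstruct tau :=
  point (fun c => v == rshift n c) (d v).

Definition interp_of (dA : {ffun V -> X} * frame tau V) : interp :=
  ([ffun P => [set v | P \in (dA.1 v).1]],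
   [ffun R => [set vw | R \in if vw.1 == vw.2 then (dA.1 vw.1).2 else dA.2 vw]]).

Definition of_interp (I : interp) : {ffun V -> X} * frame tau V :=
  ([ffun v => ([set P | v \in I.1 P], [set R | (v, v) \in I.2 R])],
   [ffun vw => if vw.1 == vw.2 then set0 else [set R | vw \in I.2 R]]).

Lemma of_interpK : cancel of_interp interp_of.
Proof.
case=> U B; congr (_, _); apply/ffunP=> S; apply/setP=> v; rewrite !ffunE !inE !ffunE.
  by rewrite inE.
by case: v => v w /=; case: eqP => [->|_]; rewrite inE.
Qed.

(** Loops are stored in [d], so [A] is recovered exactly when its diagonal is empty; this is the
    side condition for reindexing in [Sp_sum]. *)
Lemma interp_ofK d A : (of_interp (interp_of (d, A)) == (d, A)) = offdiag A.
Proof.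
apply/eqP/forallP => [[_ <-] v|oA]; first by rewrite ffunE /= eqxx.
congr (_, _); apply/ffunP=> v; rewrite !ffunE.
  rewrite [RHS]surjective_pairing; congr (_, _); apply/setP=> S; rewrite !inE !ffunE !inE //=.
  by rewrite eqxx.
case: v => v w /=; case: (eqVneq v w) => [<-|vw]; first by rewrite (eqP (oA v)).
by apply/setP=> R; rewrite !inE !ffunE !inE /= (negPf vw).
Qed.

(** A structure is the sum of its one-point blocks, so [ctype_comp] applies with the points as
    fibres. *)
Lemma models_interp_of d A :
  models (hardwired (interp_of (d, A))) phi = holds phi A (points d).
Proof.
rewrite /models sat_dec; congr dec.
rewrite (_ : map_tuple _ _ = [tuple]) ?tuple0 //.
set W := rs_of _.
apply: (@ctype_comp tau V (rel_of A) 0 0 phi W (Subst (rel_of A) (points d)) _ _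
           (id : carrier W -> V) (@blk _ _ _ (points d))).
- move=> R v w _ _ /= vw; rewrite ffunE inE /= (negPf vw) //.
- exact: (@cross_Subst _ _ _ _ _ _ id).
move=> v; rewrite ctype_fib_tag.
rewrite -(@theta_iso tau phi (points d v) W (fun _ => v)).
- suff -> : fib setT (id : carrier W -> V) v = [set v | _ in [set: unit]] by [].
  apply/setP=> w; rewrite !inE /=; apply/eqP/imsetP => [->|[_ _ ->] //].
  by exists tt; rewrite ?inE.
- by case=> [] [].
- by move=> c _ /=; rewrite ffunE.
- by move=> P _ /=; rewrite ffunE inE.
- by move=> R _ _ /=; rewrite ffunE inE /= eqxx.
Qed.

Lemma Sp_sum (C : structure_class tau) :
  (forall S : structure tau, C S <-> models S phi) ->
  Sp C n = \sum_(d : {ffun V -> X}) ext_count phi (points d).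
Proof.
move=> hC; rewrite /Sp -sum1_card (reindex_onto interp_of of_interp) /=; last first.
  by move=> I _; rewrite of_interpK.
under [RHS]eq_bigr do rewrite /ext_count -sum1_card.
rewrite pair_big_dep /=; apply: eq_bigl => -[d A].
rewrite interp_ofK !inE andbC; congr (_ && _); rewrite -models_interp_of.
by apply/asboolP/idP => /hC.
Qed.

Definition of_tuples (yt : n.-tuple X * l.-tuple X) : {ffun V -> X} :=
  [ffun v => match split v with inl i => tnth yt.1 i | inr c => tnth yt.2 c end].

Lemma of_tuples_bij : bijective of_tuples.
Proof.
exists (fun d : {ffun V -> X} => ([tuple d (lshift l i) | i < n], [tuple d (rshift n c) | c < l])).
  case=> t y; congr (_, _); apply: eq_from_tnth => i; rewrite tnth_mktuple ffunE.
    by rewrite (unsplitK (inl i)).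
  by rewrite (unsplitK (inr i)).
move=> d; apply/ffunP=> v; rewrite ffunE /= -{2}[v]splitK.
by case: (split v) => i; rewrite tnth_mktuple.
Qed.

Definition col (x : X) : Q := theta (point pred0 x).

Definition tail (y : l.-tuple X) : seq Q :=
  [seq theta (point (pred1 c) (tnth y c)) | c <- enum 'I_l].

(** Hard-wiring leaves the first n points without constants and puts exactly one on each of the last
    [l]. *)
Lemma theta_points (t : n.-tuple X) (y : l.-tuple X) :
  perm_eq [seq theta (points (of_tuples (t, y)) v) | v <- enum 'I_(n + l)]
          ([seq col x | x <- t] ++ tail y).
Proof.
have pt_ext (k k' : pred 'I_l) x : k =1 k' -> theta (point k x) = theta (point k' x).
  by move/funext=> ->.
apply/seq.permP=> a; rewrite /tail count_cat (count_map _ _ (enum V)) (count_map _ _ t)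
  (count_map _ _ (enum 'I_l)) -!sum1_count !big_enum_cond /=.
rewrite big_mkcond big_split_ord /= -!big_mkcond /=; congr (_ + _).
  rewrite -(map_tnth_enum t) big_map big_enum_cond /=; apply: eq_bigl => i.
  rewrite /points ffunE (unsplitK (inl i)) /col.
  by congr (a _); apply: pt_ext => c; apply/negbTE; rewrite eq_lrshift.
apply: eq_bigl => c; rewrite /points ffunE (unsplitK (inr c)).
congr (a _); apply: pt_ext => c' /=.
by rewrite (inj_eq (@rshift_inj _ _)).
Qed.

Lemma theta_rep_col (t : n.-tuple X) (y : l.-tuple X) :
  [seq theta (rep q) | q <- [seq col x | x <- t] ++ tail y] = [seq col x | x <- t] ++ tail y.
Proof.
rewrite map_cat /tail -!map_comp; congr (_ ++ _); apply: eq_map => x /=; exact: theta_rep.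
Qed.

Lemma Sp_weight (R : comNzRingType) (C : structure_class tau) :
  (forall S : structure tau, C S <-> models S phi) ->
  ((Sp C n)%:R = \sum_(t : n.-tuple X) \sum_y
    (ext_count phi (@rep_seq tau phi ([seq col x | x <- t] ++ tail y)))%:R :> R)%R.
Proof.
move=> hC; rewrite (Sp_sum hC) (reindex of_tuples); last exact: onW_bij of_tuples_bij.
rewrite GRing.natr_sum pair_big; apply: eq_bigr => -[t y] _ /=; congr (_%:R)%R.
by apply: (ext_count_rep 0); rewrite theta_rep_col theta_points.
Qed.
End Universe.

Lemma Sp_ring_periodic (R : finComNzRingType) (C : structure_class tau) p' k :
  (forall S : structure tau, C S <-> models S phi) -> prime p'.+2 ->
  ((p'.+2 ^ k)%:R = 0 :> R)%R ->
  eventually_periodic (fun n => (Sp C n)%:R : R)%R.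
Proof.
(* [N] is the number of groups from which [dvdn_block_count] gives divisibility by [p'.+2 ^ k]. *)
move=> hC p_pr char_R; pose N := 2 * p'.+2 ^ k.
have zero_mod a : p'.+2 ^ k %| a -> (a%:R = 0 :> R)%R.
  by move=> /dvdnP[b ->]; rewrite GRing.natrM char_R GRing.mulr0.
pose f (s : seq Q) : R := ((ext_count phi (@rep_seq tau phi s))%:R)%R.
pose F (q : Q) (j : nat) (s : seq Q) : R := ((fam p' j q s)%:R)%R.
have F0 q s : F q 0 s = f s by rewrite /F /fam block_count0.
have F_rec q j s : (F q j.+1 s =
    F q j (nseq p'.+2 q ++ s) - \sum_(E : frame tau 'I_p'.+2 | circ E) F q j (glue q E :: s))%R.
  by rewrite /F -fam_rec GRing.natrD GRing.natr_sum GRing.addrK.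
have f_perm s s' : perm_eq s s' -> f s = f s'.
  (* [F q 0] is [f] for every [q], so any colour serves here. *)
  move=> ss'; rewrite -!(F0 (col (set0, set0))).
  by congr (_%:R)%R; apply: fam_perm.
have f_rec q : exists2 a : seq (R * seq Q),
    {in a, forall x, size x.2 < p'.+2 * N} &
    forall s, (f (nseq (p'.+2 * N) q ++ s) = \sum_(x <- a) x.1 * f (x.2 ++ s))%R.
  have [//|a aN ha] := rec_pow _ (F_rec q) N.
  (* [F q N] vanishes in [R], which expresses the leading word through shorter ones. *)
  exists a => // s; have := ha s; rewrite {1}/F zero_mod; last exact: dvdn_block_count.
  rewrite F0 => /esym/eqP; rewrite GRing.subr_eq0 => /eqP ->.
  by apply: eq_bigr => x _; rewrite F0.
have [r [P [P0 hP]]] := weight_eventually_periodic f_perm f_rec col tail.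
exists r, P; split=> // n rn; have := hP n rn.
by rewrite /weight -!(Sp_weight _ _ hC).
Qed.

Lemma Sp_mod_prime_power (C : structure_class tau) p k :
  (forall S : structure tau, C S <-> models S phi) -> prime p ->
  eventually_periodic (fun n => Sp C n %% p ^ k).
Proof.
(* ['Z_M] is the ring of integers modulo [M] only for [M > 1], so exponent 0 is treated apart. *)
move=> hC p_pr; case: k => [|k].
  by exists 0, 1; split=> // n _; rewrite !modn1.
case: p p_pr => [|[|p']] // p_pr; set M := (p'.+2 ^ k.+1)%N.
have M1 : 1 < M by rewrite -(exp1n k.+1) ltn_exp2r.
have [r [P [P0 hP]]] := Sp_ring_periodic (R := 'Z_M) hC p_pr (pchar_Zp M1).
exists r, P; split=> // n rn.
by have /(congr1 (@nat_of_ord _)) := hP n rn; rewrite !val_Zp_nat.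
Qed.
End Counting.

(** * From prime powers to all moduli *)

Lemma eventually_periodic_mod (s : nat -> nat) :
  (forall p k, prime p -> eventually_periodic (fun n => s n %% p ^ k)) ->
  forall m, 0 < m -> eventually_periodic (fun n => s n %% m).
Proof.
move=> hs m; elim: {m}_.+1 {-2}m (ltnSn m) => // b IH m; rewrite ltnS => mb m0.
case: (leqP m 1) => m1.
  by exists 0, 1; split=> // n _; rewrite (_ : m = 1) ?modn1 //; apply/eqP; rewrite eqn_leq m1.
(* The p-part of [m] and its cofactor are coprime, and the cofactor is smaller than [m]; the product
   of their periods is a common period. *)
set p := pdiv m; have p_pr : prime p := pdiv_prime m1.
have mE : m = (m`_p * m`_p^')%N by rewrite partnC.
have m2 : m`_p^' < m.
  rewrite {2}mE -{1}[m`_p^']mul1n ltn_pmul2r ?part_gt0 // p_part.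
  by rewrite -(exp1n (logn p m)) ltn_exp2r ?prime_gt1 // logn_gt0 mem_primes p_pr m0 pdiv_dvd.
have [r1 [P1 [P10 h1]]] := hs p (logn p m) p_pr.
have [r2 [P2 [P20 h2]]] := IH _ (leq_trans m2 mb) (part_gt0 _ _).
exists (maxn r1 r2), (P1 * P2); split; first by rewrite muln_gt0 P10.
have mul (r P : nat) (u : nat -> nat) : (forall n, r <= n -> u (n + P) = u n) ->
    forall n j, r <= n -> u (n + P * j) = u n.
  move=> hu n j rn; elim: j => [|j]; first by rewrite muln0 addn0.
  by rewrite mulnS addnCA addnA [_ + n]addnC => <-; rewrite addnAC hu // (leq_trans rn) ?leq_addr.
move=> n; rewrite geq_max => /andP[rn1 rn2]; apply/eqP.
rewrite {1 2}mE chinese_remainder ?coprime_partC //; apply/andP; split.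
  by rewrite p_part (mul r1 _ (fun n => s n %% _)).
by rewrite mulnC (mul r2 _ (fun n => s n %% _)).
Qed.

Lemma MC_finite_periodic (s : nat -> nat) :
  (forall m, 0 < m -> eventually_periodic (fun n => s n %% m)) ->
  MC_finite (fun n => Posz (s n)).
Proof.
move=> hs m m0; have [r [P [P0 hP]]] := hs m m0.
(* The recurrence is [s (n + 2P) = s n] modulo [m]; doubling the period keeps the order parameter
   positive when [P = 1]. *)
exists r.+1, P.*2.-1, (fun i => (i == ord0)%:R%R); split=> //.
  by rewrite -subn1 subn_gt0; case: (P) P0.
move=> n rn; rewrite (bigD1 ord0) //= GRing.mul1r big1 ?GRing.addr0 => [|i /negPf ->]; last first.
  by rewrite GRing.mul0r.
rewrite addn0 -addnA addn1 prednK ?double_gt0 // -addnn addnA.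
by rewrite !modz_nat !hP // ?(leq_trans _ (leq_addr _ _)) // ltnW.
Qed.

Theorem corollary6p2 (tau : vocabulary) (C : structure_class tau)
    (hC : CMSOL_definable C) :
  MC_finite (fun n : nat => Posz (Sp C n)).
Proof.
case: hC => phi hC; apply/MC_finite_periodic/eventually_periodic_mod => p k.
exact: Sp_mod_prime_power.
Qed.
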